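(* D-SAP (defined in the context) with a weakly Pareto-conform psychological model and cost functions with Pareto dimension $k$ reduces to solving a multi-criteria shortest path problem with $k$ criteria and scoring the result. That is, in the graph obtained from $G$ by removing the edges of $Q$, with edge weights $w(e)=p(\tau_e)\in\mathbb{Q}^k$, the set of $s$–$t$ paths whose total weight is not Pareto dominated by that of another $s$–$t$ path contains an optimal solution of D-SAP.
   Context: Setting. Let $G=(V,E)$ be a directed graph, $s,t\in V$, $d>0$ rational. Every edge $e$ has a cost function $\tau_e:\mathbb{Q}_{\ge 0}\to\mathbb{Q}_{>0}$, monotonically increasing and differentiable; functions are considered on $[0,d]$ and inequalities between functions are pointwise on $[0,d]$. Paths are identified with edge sets; $\tau_A=\sum_{e\in A}\tau_e$ (zero if $A=\emptyset$), $\tau'_A$ its derivative. An original simple $s$–$t$ path $Q$ is fixed. An alternative is a simple $s$–$t$ path $P$; $\mathcal{C}_P(x)=x\,\tau_{P\setminus Q}(x)+(d-x)\,\tau_{Q\setminus P}(d-x)+d\,\tau_{P\cap Q}(d)$. A psychological model assigns to each alternative $P$ a value $x_P\in[0,d]$, and $\mathcal{C}_P:=\mathcal{C}_P(x_P)$. D-SAP asks for an alternative $P$ edge-disjoint from $Q$ minimizing $\mathcal{C}_P$. Dominance: $P_1\preceq P_2$ iff $\tau_{P_1}\le\tau_{P_2}$ and $\tau'_{P_1\cap Q}\le\tau'_{P_2\cap Q}$. The model is weakly Pareto-conform if $P_1\preceq P_2$ implies $\mathcal{C}_{P_1}\le\mathcal{C}_{P_2}$ whenever $P_1\cap Q=P_2\cap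 Q$. Standing assumption: no two different paths dominate each other mutually. A class $\mathcal{T}$ of functions on $[0,d]$ closed under addition has Pareto dimension $k$ if there is $p:\mathcal{T}\to\mathbb{Q}^k$ with $\tau_1\le\tau_2$ iff $p(\tau_1)\le p(\tau_2)$ componentwise and $p(\tau_1+\tau_2)=p(\tau_1)+p(\tau_2)$; ''cost functions with Pareto dimension $k$'' means all $\tau_e$ lie in such a class with representation $p$. A multi-criteria shortest path problem with $m$ criteria: given edge weights in $\mathbb{Q}^m$ (path weight = sum), compute all $s$–$t$ paths whose weight is not Pareto dominated (componentwise $\le$ and different) by that of another $s$–$t$ path. Scoring means computing $\mathcal{C}_P$ for each resulting path and choosing the best. *)

(* Defs.v *)
From HB Require Import structures.
From mathcomp Require Import all_boot all_order all_algebra.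
From mathcomp Require Import boolp classical_sets topology normedtype.
Set Implicit Arguments.
Unset Strict Implicit.
Unset Printing Implicit Defensive.
Import Order.TTheory GRing.Theory Num.Theory.
Import numFieldTopology.Exports numFieldNormedType.Exports.
Local Open Scope ring_scope.

(* The finite type I only supplies names for edges: the edge set of the graph
   is [edges G].  Parallel edges and loops are allowed; taking I := V * V with
   the two projections gives the digraphs whose edges are ordered pairs. *)
Record digraph (V I : finType) := Digraph {
  src : I -> V;
  tgt : I -> V;
  edges : {set I} }.

Definition del_edges (V I : finType) (G : digraph V I) (F : {set I}) :
    digraph V I :=
  Digraph (src G) (tgt G) (edges G :\: F).

Fixpoint walk (V I : finType) (G : digraph V I) (s t : V) (es : seq I) : bool :=
  if es is e :: es' then
    [&& e \in edges G, src G e == s & walk G (tgt G e) t es']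
  else s == t.

(* A path is identified with its edge set.  Simplicity is the pairwise
   distinctness of the visited vertices, start vertex included; for s = t the
   only simple path is thus the empty one. *)
Definition st_path (V I : finType) (G : digraph V I) (s t : V) (P : {set I}) :
    Prop :=
  exists es : seq I,
    [/\ walk G s t es, uniq (s :: [seq tgt G e | e <- es])
      & P = [set e in es]].

(* Functions on the nonnegative rationals are represented by functions on all
   of rat whose values at negative arguments are irrelevant: increments h with
   x + h < 0 are excluded, so the derivative at 0 is the right derivative.
   The field is abstract here because rat gets its (order) topology through
   numFieldType. *)
Definition diff_quot (R : numFieldType) (f : R -> R) (x h : R) : R :=
  h^-1 * (f (x + h) - f x).

Definition nneg_derivable (R : numFieldType) (f : R -> R) (x : R) : Prop :=
  cvg (diff_quot f x h @[h --> within [set h | 0 <= x + h] (0 : R)^'])%classic.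

Definition nneg_deriv (R : numFieldType) (f : R -> R) (x : R) : R :=
  lim (diff_quot f x h @[h --> within [set h | 0 <= x + h] (0 : R)^'])%classic.

Definition cost_function (f : rat -> rat) : Prop :=
  [/\ forall x, 0 <= x -> 0 < f x,
      forall x y, 0 <= x -> x <= y -> f x <= f y
    & forall x, 0 <= x -> nneg_derivable f x].

Definition cost_sum (I : finType) (tau : I -> rat -> rat) (A : {set I})
    (x : rat) : rat :=
  \sum_(e in A) tau e x.

Definition routing_cost (I : finType) (d : rat) (tau : I -> rat -> rat)
    (Q P : {set I}) (x : rat) : rat :=
  x * cost_sum tau (P :\: Q) x + (d - x) * cost_sum tau (Q :\: P) (d - x)
  + d * cost_sum tau (P :&: Q) d.

(* A psychological model: xm P is the value x_P, relevant for alternatives P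
   only. *)
Definition psych_model (V I : finType) (G : digraph V I) (s t : V) (d : rat)
    (xm : {set I} -> rat) : Prop :=
  forall P, st_path G s t P -> 0 <= xm P <= d.

Definition model_cost (I : finType) (d : rat) (tau : I -> rat -> rat)
    (Q : {set I}) (xm : {set I} -> rat) (P : {set I}) : rat :=
  routing_cost d tau Q P (xm P).

Definition dominates (I : finType) (d : rat) (tau : I -> rat -> rat)
    (Q P1 P2 : {set I}) : Prop :=
  forall x, 0 <= x <= d ->
    cost_sum tau P1 x <= cost_sum tau P2 x /\
    nneg_deriv (cost_sum tau (P1 :&: Q)) x
      <= nneg_deriv (cost_sum tau (P2 :&: Q)) x.

Definition no_mutual_domination (V I : finType) (G : digraph V I) (s t : V)
    (d : rat) (tau : I -> rat -> rat) (Q : {set I}) : Prop :=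
  forall P1 P2, st_path G s t P1 -> st_path G s t P2 ->
    dominates d tau Q P1 P2 -> dominates d tau Q P2 P1 -> P1 = P2.

Definition weakly_pareto_conform (V I : finType) (G : digraph V I) (s t : V)
    (d : rat) (tau : I -> rat -> rat) (Q : {set I}) (xm : {set I} -> rat) :
    Prop :=
  forall P1 P2, st_path G s t P1 -> st_path G s t P2 ->
    P1 :&: Q = P2 :&: Q -> dominates d tau Q P1 P2 ->
    model_cost d tau Q xm P1 <= model_cost d tau Q xm P2.

Definition dsap_feasible (V I : finType) (G : digraph V I) (s t : V)
    (Q P : {set I}) : Prop :=
  st_path G s t P /\ [disjoint P & Q].

Definition dsap_optimal (V I : finType) (G : digraph V I) (s t : V)
    (d : rat) (tau : I -> rat -> rat) (Q : {set I}) (xm : {set I} -> rat)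
    (P : {set I}) : Prop :=
  dsap_feasible G s t Q P /\
  forall P', dsap_feasible G s t Q P' ->
    model_cost d tau Q xm P <= model_cost d tau Q xm P'.

Definition vec_le (k : nat) (u v : 'rV[rat]_k) : Prop :=
  forall i, u 0 i <= v 0 i.

Definition pareto_dominated (k : nat) (u v : 'rV[rat]_k) : Prop :=
  vec_le v u /\ v <> u.

Definition segment (d : rat) : Type := {x : rat | 0 <= x <= d}.

Definition on_segment (d : rat) (f : rat -> rat) : segment d -> rat :=
  fun x => f (val x).
Arguments on_segment : clear implicits.

(* p is a map on the class T; it is given as a function on all functions
   [0, d] -> rat, unconstrained outside T. *)
Definition pareto_representation (d : rat) (k : nat)
    (T : set (segment d -> rat)) (p : (segment d -> rat) -> 'rV[rat]_k) :
    Prop :=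
  [/\ forall f g, T f -> T g -> T (f \+ g),
      forall f g, T f -> T g ->
        ((forall x, f x <= g x) <-> vec_le (p f) (p g))
    & forall f g, T f -> T g -> p (f \+ g) = p f + p g].

Definition path_weight (I : finType) (m : nat) (w : I -> 'rV[rat]_m)
    (P : {set I}) : 'rV[rat]_m :=
  \sum_(e in P) w e.

Definition mcsp_solution (V I : finType) (G : digraph V I) (s t : V)
    (m : nat) (w : I -> 'rV[rat]_m) (P : {set I}) : Prop :=
  st_path G s t P /\
  forall P', st_path G s t P' ->
    ~ pareto_dominated (path_weight w P) (path_weight w P').

Definition best_scored (I : finType) (d : rat) (tau : I -> rat -> rat)
    (Q : {set I}) (xm : {set I} -> rat) (S : {set I} -> Prop) (P : {set I}) :
    Prop :=
  S P /\
  forall P', S P' -> model_cost d tau Q xm P <= model_cost d tau Q xm P'.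

(* Main.v *)
Require Import Defs.
From HB Require Import structures.
From mathcomp Require Import all_boot all_order all_algebra.
From mathcomp Require Import boolp classical_sets.
Set Implicit Arguments.
Unset Strict Implicit.
Unset Printing Implicit Defensive.
Import Order.TTheory GRing.Theory Num.Theory.
Local Open Scope ring_scope.

(* On the edges outside Q, additivity of p makes the weight of a nonempty path
   the Pareto representation of its cost.  So a componentwise comparison of
   weights is a comparison of costs on [0, d], and since such paths meet Q in
   the same (empty) set, weak Pareto-conformity turns it into a comparison of
   model costs.  As there are finitely many paths, below every weight lies a
   non-dominated one. *)

Section Paths.
Variables (V I : finType) (G : digraph V I).

Lemma walk_last s t es : walk G s t es -> last s [seq tgt G e | e <- es] = t.
Proof.
by elim: es s => [|e es IH] s /=; [move/eqP | case/and3P=> _ _; exact: IH].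
Qed.

Lemma walk_sub s t es : walk G s t es -> {subset es <= edges G}.
Proof.
elim: es s => [|e es IH] s //= /and3P[eG _ /IH sub] f.
by rewrite inE => /predU1P[->|/sub].
Qed.

Lemma walk_del_edges (F : {set I}) s t es :
  walk (del_edges G F) s t es = walk G s t es && all (fun e => e \notin F) es.
Proof.
elim: es s => [|e es IH] s /=; first by rewrite andbT.
by rewrite IH inE; case: (e \in F); rewrite /= ?andbF //= !andbA.
Qed.

Lemma st_path_sub s t P : st_path G s t P -> P \subset edges G.
Proof.
by case=> es [/walk_sub sub _ ->]; apply/fintype.subsetP => e; rewrite inE => /sub.
Qed.

(** An empty path forces [s = t], and a nonempty walk from [s] back to [s] repeats its start vertex,
    against simplicity. This settles the case in which a path has no edges and its cost need not lie
    in [T]. *)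
Lemma st_path_set0 s t P :
  st_path G s t finset.set0 -> st_path G s t P -> P = finset.set0.
Proof.
case=> es0 [w0 _ es00] [es [w u ->]].
case: es0 w0 es00 => [|e es0 _ /setP/(_ e)]; last by rewrite !inE eqxx.
move=> /eqP st _; rewrite -{}st in w.
case: es w u => [|e es] w; first by move=> _; apply/setP => e; rewrite !inE.
move=> /andP[/negP[]].
have /= last_s := walk_last w.
by have := mem_last (tgt G e) [seq tgt G f | f <- es]; rewrite last_s.
Qed.

Lemma dsap_feasibleE s t Q P :
  dsap_feasible G s t Q P <-> st_path (del_edges G Q) s t P.
Proof.
split=> [[[es [w u ->]] PQ]|[es [w u ->]]].
  exists es; split=> //; rewrite walk_del_edges w; apply/allP => e ees.
  by rewrite (disjointFr PQ) // inE.
move: w; rewrite walk_del_edges => /andP[w /allP esQ].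
split; first by exists es.
by apply/pred0P => e /=; rewrite inE; apply/negP => /andP[/esQ/negP].
Qed.

End Paths.

Section Weights.
Variables (I : finType) (d : rat) (tau : I -> rat -> rat) (k : nat).
Variables (T : set (segment d -> rat)) (p : (segment d -> rat) -> 'rV[rat]_k).
Hypothesis p_repr : pareto_representation T p.

Let w e := p (on_segment d (tau e)).

(* The empty sum is excluded: T need not contain the zero function. *)
Lemma path_weightE (P : {set I}) : P != finset.set0 ->
  (forall e, e \in P -> T (on_segment d (tau e))) ->
  T (on_segment d (cost_sum tau P)) /\
  p (on_segment d (cost_sum tau P)) = path_weight w P.
Proof.
case: p_repr => TD _ pD P0 PT.
have -> : cost_sum tau P = fun x => \sum_(e <- enum P) tau e x.
  by apply/funext => x; rewrite big_enum.
rewrite /path_weight -big_enum.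
have : {in enum P, forall e, T (on_segment d (tau e))}.
  by move=> e; rewrite mem_enum; exact: PT.
have : enum P != [::] by rewrite -size_eq0 -cardE cards_eq0.
elim: (enum P) => // e r IH _ rT.
have eT := rT e (mem_head e r).
(* The one-edge list is the real base case; additivity of [p] enters only for longer lists. *)
have [->|r0] := eqVneq r [::].
  rewrite big_seq1.
  suff -> : on_segment d (fun x => \sum_(f <- [:: e]) tau f x) =
            on_segment d (tau e) by [].
  by apply/funext => x; rewrite /on_segment big_seq1.
have [sT ps] := IH r0 (fun f fr => rT f (@mem_behead _ (e :: r) f fr)).
have -> : on_segment d (fun x => \sum_(f <- e :: r) tau f x) =
          on_segment d (tau e) \+ on_segment d (fun x => \sum_(f <- r) tau f x).
  by apply/funext => x; rewrite /on_segment big_cons.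
by rewrite big_cons pD // ps; split=> //; exact: TD.
Qed.

(** Both cost sums lie in [T] and are represented by the path weights, so the order of the weights
    is reflected back to the functions. *)
Lemma cost_sum_le (P1 P2 : {set I}) (x : rat) :
  P1 != finset.set0 -> P2 != finset.set0 ->
  (forall e, e \in P1 :|: P2 -> T (on_segment d (tau e))) ->
  vec_le (path_weight w P1) (path_weight w P2) ->
  0 <= x <= d -> cost_sum tau P1 x <= cost_sum tau P2 x.
Proof.
move=> P10 P20 PT w12 xd; case: p_repr => _ p_le _.
have [|T1 p1] := path_weightE P10; first by move=> e eP; apply: PT; rewrite inE eP.
have [|T2 p2] := path_weightE P20.
  by move=> e eP; apply: PT; rewrite inE eP orbT.
move: w12; rewrite -p1 -p2 => /(p_le _ _ T1 T2).
by move=> /(_ (exist _ x xd)).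
Qed.

End Weights.

Lemma vec_le_trans k (v u w : 'rV[rat]_k) :
  vec_le u v -> vec_le v w -> vec_le u w.
Proof. by move=> uv vw i; exact: le_trans (uv i) (vw i). Qed.

(* The coordinate sum is strictly monotone for Pareto domination, so its
   minimizers below a given weight are not dominated. *)
Lemma mcsp_solution_below (V I : finType) (G : digraph V I) s t m
    (w : I -> 'rV[rat]_m) P : st_path G s t P ->
  exists2 P', mcsp_solution G s t w P' &
    vec_le (path_weight w P') (path_weight w P).
Proof.
move=> PG.
pose below P' :=
  `[< st_path G s t P' /\ vec_le (path_weight w P') (path_weight w P) >].
have PP : below P by apply/asboolP; split.
case: (arg_minP (fun P' => \sum_i path_weight w P' 0 i) PP).
move=> P1 /asboolP[P1G P1P] P1min; exists P1 => //; split=> // P2 P2G [w21 neq].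
(* By transitivity a path dominating [P1] is itself a candidate for the minimum, so its coordinate
   sum is no smaller. *)
have /P1min : below P2.
  by apply/asboolP; split=> //; exact: vec_le_trans w21 P1P.
move=> le12; apply: neq; apply/rowP => i.
have sub_ge0 j : true -> 0 <= path_weight w P1 0 j - path_weight w P2 0 j.
  by rewrite subr_ge0.
(* The differences are nonnegative while minimality bounds their sum by 0, so each of them vanishes
   and the two weights agree. *)
have : \sum_j (path_weight w P1 0 j - path_weight w P2 0 j) == 0.
  by rewrite eq_le sumr_ge0 // sumrB subr_le0 le12.
by rewrite (psumr_eq0 _ sub_ge0) => /allP/(_ i (mem_index_enum i))/=;
  rewrite subr_eq0 => /eqP.
Qed.

Theorem theorem6 (V I : finType) (G : digraph V I) (s t : V)
  (d : rat) (d_gt0 : 0 < d)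
  (tau : I -> rat -> rat)
  (tau_cost : forall e, e \in edges G -> cost_function (tau e))
  (Q : {set I}) (Q_path : st_path G s t Q)
  (no_mutual : no_mutual_domination G s t d tau Q)
  (xm : {set I} -> rat) (xm_model : psych_model G s t d xm)
  (xm_conform : weakly_pareto_conform G s t d tau Q xm)
  (k : nat) (T : set (segment d -> rat))
  (p : (segment d -> rat) -> 'rV[rat]_k)
  (p_repr : pareto_representation T p)
  (tau_in_T : forall e, e \in edges G -> T (on_segment d (tau e))) :
  let result := mcsp_solution (del_edges G Q) s t
                  (fun e => p (on_segment d (tau e))) in
  ((exists P, dsap_feasible G s t Q P) ->
     exists P, result P /\ dsap_optimal G s t d tau Q xm P) /\
  (forall P, best_scored d tau Q xm result P ->
     dsap_optimal G s t d tau Q xm P).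
Proof.
move=> result.
have cost_le P1 P2 : dsap_feasible G s t Q P1 -> dsap_feasible G s t Q P2 ->
    vec_le (path_weight (fun e => p (on_segment d (tau e))) P1)
      (path_weight (fun e => p (on_segment d (tau e))) P2) ->
    model_cost d tau Q xm P1 <= model_cost d tau Q xm P2.
  move=> [P1G P1Q] [P2G P2Q] w12.
  (* If either path is empty, both are, and their costs coincide. *)
  have [P10|P10] := eqVneq P1 finset.set0.
    by rewrite P10 in P1G *; rewrite (st_path_set0 P1G P2G).
  have [P20|P20] := eqVneq P2 finset.set0.
    by rewrite P20 in P2G *; rewrite (st_path_set0 P2G P1G).
  have PQ : P1 :&: Q = P2 :&: Q by rewrite !disjoint_setI0.
  (* Once the intersections with [Q] are identified, the derivative half of dominance is
     reflexivity; only the costs remain to be compared. *)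
  apply: xm_conform => // x xd; rewrite PQ; split=> //.
  apply: (cost_sum_le p_repr P10 P20) => // e eP.
  apply: tau_in_T; apply: (fintype.subsetP _ _ eP).
  by rewrite finset.subUset !(st_path_sub P1G, st_path_sub P2G).
have feas P : result P -> dsap_feasible G s t Q P.
  by case=> PG _; apply/dsap_feasibleE.
have better P : dsap_feasible G s t Q P -> exists2 P', result P' &
    model_cost d tau Q xm P' <= model_cost d tau Q xm P.
  move=> Pf; have /dsap_feasibleE/mcsp_solution_below := Pf.
  move=> /(_ _ (fun e => p (on_segment d (tau e))))[P' P'r P'P].
  by exists P' => //; apply: cost_le => //; exact: feas.
split=> [[P /asboolP Pf]|P [Pr Pbest]].
  (* An optimum exists among the finitely many feasible paths; the non-dominated path below it costs
     no more, hence is optimal too. *)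
  case: (arg_minP (P := fun P' => `[< dsap_feasible G s t Q P' >])
           (model_cost d tau Q xm) Pf).
  move=> P0 /asboolP/better[P1 P1r P10] P0min.
  exists P1; split=> //; split=> [|P' /asboolP/P0min]; first exact: feas.
  exact: le_trans.
(* A feasible competitor is compared with the best-scored path through a non-dominated path that
   costs no more than the competitor. *)
split=> [|P' /better[P1 /Pbest]]; first exact: feas.
exact: le_trans.
Qed.
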